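(* Let $\{\pi^k\}_{k\ge0}$ be generated by softmax natural policy gradient (softmax NPG) with any constant step size $\eta>0$, and let $\sigma>0$ be an arbitrary constant. Then there exists a time $T(\sigma)$ such that for all $k\ge T(\sigma)$, $$V^*(\rho)-V^k(\rho)\ge\tilde\rho\,\Delta\,\min_{s,a}\pi^{T(\sigma)}(a|s)\,\exp\left(-\eta(\Delta+\sigma)(k-T(\sigma))\right).$$
   Context: MDP: a tuple $(\mathcal{S},\mathcal{A},P,r,\gamma)$ with finite state space $\mathcal{S}$, finite action space $\mathcal{A}$, transition probabilities $P(s'|s,a)$, reward $r:\mathcal{S}\times\mathcal{A}\to[0,1]$ and discount factor $\gamma\in[0,1)$. A policy is $\pi=(\pi(\cdot|s))_{s\in\mathcal{S}}$ with each $\pi(\cdot|s)$ a probability distribution on $\mathcal{A}$. Values: $V^\pi(s)=\mathbb{E}[\sum_{t\ge0}\gamma^t r(s_t,a_t)\mid s_0=s,\pi]$, $Q^\pi(s,a)=\mathbb{E}[\sum_{t\ge0}\gamma^t r(s_t,a_t)\mid s_0=s,a_0=a,\pi]$, $A^\pi=Q^\pi-V^\pi$, and $V^\pi(\rho)=\mathbb{E}_{s\sim\rho}[V^\pi(s)]$ (similarly $V^*(\rho)$). $V^*,Q^*$ are the optimal values and $A^*(s,a)=Q^*(s,a)-V^*(s)$. For policies $\pi^k$, write $V^k,A^k$ for $V^{\pi^k},A^{\pi^k}$. Optimal advantage gap: $\mathcal{A}_s^*=\arg\max_aA^*(s,a)$, $\tilde{\mathcal S}=\{s:\mathcal{A}_s^*\ne\mathcal{A}\}$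 (assumed nonempty, so that the gap is defined), $\Delta=\min_{s\in\tilde{\mathcal S},\,a\notin\mathcal{A}_s^*}|A^*(s,a)|$. $\rho$ is an arbitrary probability distribution on $\mathcal{S}$ with $\tilde\rho=\min_s\rho(s)>0$. Softmax NPG: start from any policy $\pi^0$ with all entries positive (a softmax policy) and iterate $\pi^{k+1}(a|s)=\dfrac{\pi^k(a|s)\exp(\eta A^k(s,a))}{\sum_{a'}\pi^k(a'|s)\exp(\eta A^k(s,a'))}$. *)

(* Defs.v *)
From HB Require Import structures.
From mathcomp Require Import all_boot all_order all_algebra.
From mathcomp Require Import all_classical all_reals all_analysis.
From mathcomp Require Import lra.
Set Implicit Arguments.
Unset Strict Implicit.
Unset Printing Implicit Defensive.
Import Order.TTheory GRing.Theory Num.Theory.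
Import numFieldNormedType.Exports.
Local Open Scope classical_set_scope.
Local Open Scope ring_scope.

Record dist (R : realType) (T : finType) := Dist {
  prob :> T -> R;
  dist_ge0 : forall x, 0 <= prob x;
  dist_sum1 : \sum_x prob x = 1 }.

Section DiracDist.
Context (R : realType) (T : finType) (x0 : T).

Let prob_dirac x : R := (x == x0)%:R.

Let prob_dirac_ge0 x : 0 <= prob_dirac x. Proof. exact: ler0n. Qed.

Let prob_dirac_sum1 : \sum_x prob_dirac x = 1.
Proof.
rewrite (bigD1 x0)//= /prob_dirac eqxx big1 ?addr0// => x /negbTE.
by move=> ->.
Qed.

Definition dist_dirac : dist R T := Dist prob_dirac_ge0 prob_dirac_sum1.

End DiracDist.

Section PairDist.
Context (R : realType) (T U : finType) (p : dist R T) (q : T -> dist R U).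

Let prob_pair (xy : T * U) : R := p xy.1 * q xy.1 xy.2.

Let prob_pair_ge0 xy : 0 <= prob_pair xy.
Proof. by apply: mulr_ge0; exact: dist_ge0. Qed.

Let prob_pair_sum1 : \sum_xy prob_pair xy = 1.
Proof.
rewrite -(dist_sum1 p) -(pair_bigA _ (fun x y => p x * q x y))/=.
by apply: eq_bigr => x _; rewrite -mulr_sumr dist_sum1 mulr1.
Qed.

Definition dist_pair : dist R (T * U)%type :=
  Dist prob_pair_ge0 prob_pair_sum1.

End PairDist.

Record markov_chain (R : realType) (X : finType) (mu : dist R X)
    (K : X -> dist R X) := MarkovChain {
  chain_display : measure_display;
  chain_space : measurableType chain_display;
  chain_prob : probability chain_space R;
  chain_at : nat -> chain_space -> X;
  measurable_chain : forall t x, measurable [set w | chain_at t w = x];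
  chain_law : forall (x : nat -> X) (n : nat),
    chain_prob [set w | forall t, (t <= n)%N -> chain_at t w = x t] =
    (mu (x 0%N) * \prod_(t < n) K (x t) (x t.+1))%:E }.

Arguments chain_prob {R X mu K} m.
Arguments chain_at {R X mu K} m t w.
Arguments measurable_chain {R X mu K} m t x.
Arguments chain_law {R X mu K} m x n.

(* Every initial law and kernel on a finite type admit such a chain: it is     *)
(* sampled from a uniform u in [0, 1[, by repeatedly cutting the current       *)
(* interval (starting from [0, 1[) proportionally to the law of the next state *)
(* and moving to the piece that contains u.                                    *)

Section Quantile.
Context (R : realType) (X : finType).
Implicit Types p : dist R X.

Definition cumul p (i : nat) : R := \sum_(y | (enum_rank y < i)%N) p y.

Definition in_slot p (v : R) (x : X) : bool :=
  cumul p (enum_rank x) <= v < cumul p (enum_rank x) + p x.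

Lemma cumulS p (x : X) : cumul p (enum_rank x).+1 = cumul p (enum_rank x) + p x.
Proof.
rewrite /cumul (bigD1 x)//= addrC; congr (_ + _); apply: eq_bigl => y.
rewrite ltnS leq_eqVlt; have [->|yx] := eqVneq y x; first by rewrite andbF ltnn.
rewrite andbT; case: eqP => //= /val_inj/enum_rank_inj yx'.
by rewrite yx' eqxx in yx.
Qed.

Lemma cumul_le p i j : (i <= j)%N -> cumul p i <= cumul p j.
Proof.
move=> ij; rewrite /cumul [leRHS](bigID (fun y => (enum_rank y < i)%N))/=.
rewrite [X in _ <= X + _](_ : _ = cumul p i).
  by rewrite lerDl; apply: sumr_ge0 => y _; exact: dist_ge0.
apply: eq_bigl => y; case: (ltnP (enum_rank y) i) => yi; rewrite ?andbF//.
by rewrite (leq_trans yi ij).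
Qed.

Lemma cumul0 p : cumul p 0 = 0. Proof. by rewrite /cumul big_pred0. Qed.

Lemma cumul1 p : cumul p #|X| = 1.
Proof.
by rewrite -(dist_sum1 p) /cumul; apply: eq_bigl => y; rewrite ltn_ord.
Qed.

Lemma cumul_ge0 p i : 0 <= cumul p i.
Proof. by rewrite -(cumul0 p) cumul_le. Qed.

Lemma cumulD_le1 p x : cumul p (enum_rank x) + p x <= 1.
Proof. by rewrite -cumulS -(cumul1 p) cumul_le. Qed.

Lemma in_slot_ex p v : 0 <= v < 1 -> exists x, in_slot p v x.
Proof.
move=> /andP[v0 v1].
have ex : exists i, v < cumul p i by exists #|X|; rewrite cumul1.
case: (ex_minnP ex) => -[|i] vi imin; first by rewrite cumul0 ltNge v0 in vi.
have iX : (i < #|X|)%N by apply: imin; rewrite cumul1.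
exists (enum_val (Ordinal iX)); rewrite /in_slot -cumulS enum_valK/= vi andbT.
by rewrite leNgt; apply/negP => /imin; rewrite ltnn.
Qed.

Lemma in_slot_inj p v x y : in_slot p v x -> in_slot p v y -> x = y.
Proof.
wlog xy : x y / (enum_rank x <= enum_rank y)%N.
  move=> H hx hy; have [/H|/ltnW/H] := leqP (enum_rank x) (enum_rank y).
    exact.
  by move=> /(_ hy hx).
rewrite /in_slot -!cumulS => /andP[_ vx] /andP[vy _].
move: xy; rewrite leq_eqVlt => /orP[/eqP/val_inj/enum_rank_inj//|].
by move/(cumul_le p)/(le_trans)/(_ vy); rewrite leNgt vx.
Qed.

Lemma dist_inhabited p : exists x : X, true.
Proof.
apply: contrapT => X0; have /eqP := dist_sum1 p.
by rewrite big1 ?(eq_sym 0) ?oner_eq0// => x; case: X0; exists x.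
Qed.

Definition dist_point p : X := xchoose (dist_inhabited p).

Definition quantile p (v : R) : X := odflt (dist_point p) [pick x | in_slot p v x].

Lemma quantileE p v x : 0 <= v < 1 -> (quantile p v = x) <-> in_slot p v x.
Proof.
move=> v01; rewrite /quantile; case: pickP => [y vy|no] /=.
  by split=> [<-//|]; exact: in_slot_inj.
by have [z] := in_slot_ex p v01; rewrite no.
Qed.

End Quantile.

Section UnitProb.
Context (R : realType).

Definition unit_itv : set (measurableTypeR R) := [set` `[0%R, 1%R[].

Lemma measurable_unit_itv : measurable unit_itv.
Proof. exact: measurable_itv. Qed.

Definition unit_prob : set (measurableTypeR R) -> \bar R :=
  mrestr lebesgue_measure measurable_unit_itv.

HB.instance Definition _ := Measure.on unit_prob.

Let unit_prob_setT : unit_prob setT = 1%E.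
Proof.
rewrite /unit_prob /mrestr setTI /unit_itv lebesgue_measure_itv/=.
by rewrite lte_fin ltr01 oppr0 adde0.
Qed.

HB.instance Definition _ :=
  Measure_isProbability.Build _ _ _ unit_prob unit_prob_setT.

End UnitProb.

Section ChainExists.
Context (R : realType) (X : finType) (mu : dist R X) (K : X -> dist R X).

Let step (u : R) (p : dist R X) (lw : R * R) : X * (R * R) :=
  let x := quantile p ((u - lw.1) / lw.2) in
  (x, (lw.1 + lw.2 * cumul p (enum_rank x), lw.2 * p x)).

Let sample_state (u : R) : nat -> X * (R * R) :=
  fix f t := if t is t'.+1 then step u (K (f t').1) (f t').2
             else step u mu (0, 1).

Let sample (t : nat) (u : measurableTypeR R) : X :=
  if (0 <= u < 1) then (sample_state u t).1 else dist_point mu.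

Let piece (p : dist R X) (lw : R * R) (x : X) : R * R :=
  (lw.1 + lw.2 * cumul p (enum_rank x), lw.2 * p x).

Let pieces (x : nat -> X) : nat -> R * R :=
  fix f t := if t is t'.+1 then piece (K (x t')) (f t') (x t)
             else piece mu (0, 1) (x 0%N).

Let inside (u : R) (lw : R * R) := lw.1 <= u < lw.1 + lw.2.

Let stepP u p lw x : inside u lw ->
  ((step u p lw).1 = x <-> inside u (piece p lw x)) /\
  ((step u p lw).1 = x -> step u p lw = (x, piece p lw x)).
Proof.
case: lw => l w; rewrite /inside /= => /andP[lu uw]; split; last by move=> <-.
have w0 : 0 < w by lra.
rewrite quantileE; last first.
  by rewrite divr_ge0 ?ltr_pdivrMr//=; lra.
rewrite /in_slot ler_pdivlMr// ltr_pdivrMr// lerBrDl ltrBlDl.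
by rewrite -addrA -mulrDr [_ * w]mulrC [(_ + _) * w]mulrC.
Qed.

Let pieceW u p lw x : 0 <= lw.2 -> inside u (piece p lw x) -> inside u lw.
Proof.
case: lw => l w /= w0; rewrite /inside/= -addrA -mulrDr => /andP[lu uw].
have := cumul_ge0 p (enum_rank x); have := cumulD_le1 p x => c1 c0.
rewrite (le_trans _ lu) ?lerDl ?mulr_ge0//=.
by apply: (lt_le_trans uw); rewrite lerD2l ler_piMr.
Qed.

Let pieces2 x n : (pieces x n).2 = mu (x 0%N) * \prod_(t < n) K (x t) (x t.+1).
Proof.
elim: n => [|n /= ->]; first by rewrite /= big_ord0 mul1r mulr1.
by rewrite big_ord_recr mulrA.
Qed.

Let pieces2_ge0 x n : 0 <= (pieces x n).2.
Proof.
by rewrite pieces2 mulr_ge0 ?dist_ge0// prodr_ge0// => i _; exact: dist_ge0.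
Qed.

Let sample_stateP u x n : 0 <= u < 1 ->
  ((forall t, (t <= n)%N -> (sample_state u t).1 = x t) <->
   inside u (pieces x n)) /\
  ((forall t, (t <= n)%N -> (sample_state u t).1 = x t) ->
   sample_state u n = (x n, pieces x n)).
Proof.
move=> u01; elim: n => [|n [IH1 IH2]].
  have i01 : inside u (0, 1) by rewrite /inside/= add0r.
  have [h1 h2] := stepP mu (x 0%N) i01.
  have e0 : (forall t, (t <= 0)%N -> (sample_state u t).1 = x t) <->
      (step u mu (0, 1)).1 = x 0%N.
    by split=> [/(_ 0%N)->//|h t]; rewrite leqn0 => /eqP ->.
  by split; [rewrite e0|move=> /e0].
have eS : (forall t, (t <= n.+1)%N -> (sample_state u t).1 = x t) <->
    (forall t, (t <= n)%N -> (sample_state u t).1 = x t) /\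
    (sample_state u n.+1).1 = x n.+1.
  split=> [h|[h1 h2] t]; first by split=> [t tn|]; apply: h => //; exact: leqW.
  by rewrite leq_eqVlt ltnS => /orP[/eqP ->//|]; exact: h1.
have H : (forall t, (t <= n)%N -> (sample_state u t).1 = x t) ->
  ((sample_state u n.+1).1 = x n.+1 <-> inside u (pieces x n.+1)) /\
  ((sample_state u n.+1).1 = x n.+1 ->
     sample_state u n.+1 = (x n.+1, pieces x n.+1)).
  by move=> h; rewrite /= (IH2 h)/=; apply: stepP; exact/IH1.
split; last by move=> /eS[/H[_]].
rewrite eS; split; first by case=> /H[+ _] => /[apply].
move=> i; have i' : inside u (pieces x n) by exact: (pieceW (pieces2_ge0 _ _) i).
by split; [exact/IH1|apply/(H _).1 => //; exact/IH1].
Qed.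

Let pieces_sub01 u x n : inside u (pieces x n) -> 0 <= u < 1.
Proof.
elim: n => [|n IH] i; last by apply: IH; exact: (pieceW (pieces2_ge0 _ _) i).
by move/pieceW : i => /=/(_ ler01); rewrite /inside/= add0r.
Qed.

Let cylinder x n : set (measurableTypeR R) :=
  [set u | forall t, (t <= n)%N -> sample t u = x t].

Let cylinder01 x n :
  cylinder x n `&` @unit_itv R =
  [set` `[(pieces x n).1, (pieces x n).1 + (pieces x n).2[].
Proof.
apply/seteqP; split => u /=.
  rewrite /unit_itv/= !in_itv/= => -[h u01].
  by apply/(sample_stateP x n u01).1 => t /h; rewrite /sample u01.
rewrite /unit_itv/= !in_itv/= => i; have u01 := pieces_sub01 i.
by split=> // t tn; rewrite /sample u01; move: t tn; exact/(sample_stateP x n u01).1.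
Qed.

Let cylinder01C x n :
  cylinder x n `&` ~` @unit_itv R = set0 \/
  cylinder x n `&` ~` @unit_itv R = ~` @unit_itv R.
Proof.
have [h|h] := pselect (forall t, (t <= n)%N -> dist_point mu = x t).
  right; rewrite setIidr// => u; rewrite /unit_itv/= in_itv/= => /negP/negbTE u01.
  by move=> t /h; rewrite /sample u01.
left; apply/seteqP; split => u //= [hu].
rewrite /unit_itv/= in_itv/= => /negP/negbTE u01.
by apply: h => t /hu; rewrite /sample u01.
Qed.

Let measurable_cylinder x n : measurable (cylinder x n).
Proof.
rewrite -[cylinder x n]setIT -(setUv (@unit_itv R)) setIUr setUC.
apply: measurableU; last by rewrite cylinder01; exact: measurable_itv.
have [->|->] := cylinder01C x n; first exact: measurable0.
by apply: measurableC; exact: measurable_unit_itv.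
Qed.

Let measurable_sample t y : measurable [set u | sample t u = y].
Proof.
pose ext (h : {ffun 'I_t.+1 -> X}) i := h (inord i).
rewrite (_ : [set u | _] =
    \bigcup_(h in [set h : {ffun 'I_t.+1 -> X} | h ord_max = y])
      cylinder (ext h) t); last first.
  apply/seteqP; split => u /=.
    move=> uy; exists [ffun i : 'I_t.+1 => sample i u] => /=; first by rewrite ffunE.
    by move=> i it; rewrite /ext ffunE inordK.
  move=> [h hy hu]; rewrite (hu t)// /ext -hy; congr (h _).
  by apply: val_inj; rewrite /= inordK.
by apply: fin_bigcup_measurable => //; exact: finite_finset.
Qed.

Let sample_law x n :
  unit_prob (cylinder x n) = (mu (x 0%N) * \prod_(t < n) K (x t) (x t.+1))%:E.
Proof.
rewrite /unit_prob /mrestr cylinder01 lebesgue_measure_itv/= lte_fin -pieces2.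
rewrite ltrDl; case: ltP => [_|w0]; first by rewrite -EFinB addrAC subrr add0r.
by congr EFin; apply/eqP; rewrite eq_le w0 pieces2_ge0.
Qed.

Definition sampled_chain : markov_chain mu K :=
  MarkovChain (chain_prob := @unit_prob R) measurable_sample sample_law.

End ChainExists.

Record MDP (R : realType) (S A : finType) := {
  trans : S -> A -> dist R S;
  reward : S -> A -> R;
  discount : R;
  reward_itv : forall s a, 0 <= reward s a <= 1;
  discount_itv : 0 <= discount < 1 }.

Definition policy (R : realType) (S A : finType) := S -> dist R A.

Section Values.
Context (R : realType) (S A : finType) (M : MDP R S A).
Implicit Types (pi : policy R S A) (rho : dist R S).

(* The process (s_t, a_t): [init] is the law of (s_0, a_0), so that conditioning *)
(* on s_0 = s, or on s_0 = s and a_0 = a, is a choice of [init].                 *)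
Definition trajectory pi (init : dist R (S * A)%type) :
    markov_chain init (fun sa => dist_pair (trans M sa.1 sa.2) pi) :=
  sampled_chain _ _.

Definition discounted_return (z : nat -> S * A) : R :=
  limn (series (fun t => discount M ^+ t * reward M (z t).1 (z t).2)).

Definition expected_return pi (init : dist R (S * A)%type) : R :=
  fine 'E_(chain_prob (trajectory pi init))
    [fun w => discounted_return (fun t => chain_at (trajectory pi init) t w)].

Definition value pi (s : S) : R :=
  expected_return pi (dist_pair (dist_dirac R s) pi).

Definition qvalue pi (s : S) (a : A) : R :=
  expected_return pi (dist_dirac R (s, a)).

Definition advantage pi s a : R := qvalue pi s a - value pi s.

Definition mean rho (f : S -> R) : R := \sum_s rho s * f s.

(* The optimum is over the stationary randomized policies of type [policy]. *)
Definition opt_value (s : S) : R := sup [set value pi s | pi in setT].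

Definition opt_qvalue (s : S) (a : A) : R := sup [set qvalue pi s a | pi in setT].

Definition opt_advantage s a : R := opt_qvalue s a - opt_value s.

Definition opt_actions (s : S) : set A :=
  [set a | forall b, opt_advantage s b <= opt_advantage s a].

Definition nontrivial_states : set S := [set s | opt_actions s != setT].

(* Minima over finite nonempty sets are written with [inf]. *)
Definition gap : R :=
  inf [set `|opt_advantage sa.1 sa.2| | sa in
        [set sa : S * A | nontrivial_states sa.1 /\ ~ opt_actions sa.1 sa.2]].

Definition min_dist rho : R := inf (range rho).

Definition min_policy pi : R := inf (range (fun sa : S * A => pi sa.1 sa.2)).

Definition softmax_npg (eta : R) (pi : nat -> policy R S A) : Prop :=
  (forall s a, 0 < pi 0%N s a) /\
  forall k s a,
    pi k.+1 s a =
    pi k s a * expR (eta * advantage (pi k) s a) /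
    \sum_b pi k s b * expR (eta * advantage (pi k) s b).

End Values.

(* Main.v *)
(** The normalizer Z_k(s) of the update satisfies ln Z_k(s) <= eta (V^{k+1}(s) -
    V^k(s)), because relative entropies are nonnegative and V^k is increasing.
    Hence pi^k(a|s) is multiplied at step k by at least exp(eta c_k) with
    c_k = A^k(s,a) - (V^{k+1}(s) - V^k(s)), and c_k tends to A^oo(s,a), the
    advantage for V^oo = lim V^k. Since probabilities are at most 1, A^oo <= 0,
    so V^oo dominates its Bellman backup and V^oo = V^*. For a pair (s,a) with
    |A^*(s,a)| < Delta + sigma, eventually c_k >= - (Delta + sigma), which bounds
    pi^k(a|s) from below; and V^*(s) - V^k(s) >= |A^*(s,a)| pi^k(a|s). *)

Require Import Defs.
From mathcomp Require Import all_boot all_order all_algebra.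
From mathcomp Require Import all_classical all_reals all_analysis.
From mathcomp Require Import measurable_realfun lra ring.
Import Order.TTheory GRing.Theory Num.Theory.
Import numFieldNormedType.Exports.
Local Open Scope classical_set_scope.
Local Open Scope ring_scope.
Set Implicit Arguments.
Unset Strict Implicit.
Unset Printing Implicit Defensive.

(** * Means under a distribution on a finite type *)

Section Mean.
Context (R : realType) (X : finType).
Implicit Types (p : dist R X) (f g : X -> R).

Lemma mean_le p f g : (forall x, f x <= g x) -> mean p f <= mean p g.
Proof. by move=> fg; apply: ler_sum => x _; rewrite ler_wpM2l ?dist_ge0. Qed.

Lemma mean_cst p (c : R) : mean p (fun=> c) = c.
Proof. by rewrite /mean -mulr_suml dist_sum1 mul1r. Qed.

Lemma meanD p f g : mean p (fun x => f x + g x) = mean p f + mean p g.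
Proof. by rewrite /mean -big_split; apply: eq_bigr => x _; rewrite mulrDr. Qed.

Lemma meanN p f : mean p (fun x => - f x) = - mean p f.
Proof. by rewrite /mean -sumrN; apply: eq_bigr => x _; rewrite mulrN. Qed.

Lemma meanZ p (c : R) f : mean p (fun x => c * f x) = c * mean p f.
Proof. by rewrite /mean mulr_sumr; apply: eq_bigr => x _; rewrite mulrCA. Qed.

Lemma mean_dirac x f : mean (dist_dirac R x) f = f x.
Proof.
rewrite /mean (bigD1 x)//= eqxx mul1r big1 ?addr0// => y /negbTE ->.
by rewrite mul0r.
Qed.

Lemma mean_pair (Y : finType) p (q : X -> dist R Y) (f : X * Y -> R) :
  mean (dist_pair p q) f = mean p (fun x => mean (q x) (fun y => f (x, y))).
Proof.
transitivity (\sum_x \sum_y p x * q x y * f (x, y)).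
  by rewrite pair_bigA; apply: eq_bigr => -[x y].
apply: eq_bigr => x _; rewrite mulr_sumr.
by apply: eq_bigr => y _; rewrite mulrA.
Qed.

Lemma cvg_mean p (u : nat -> X -> R) f :
  (forall x, u^~ x @ \oo --> f x) -> mean p (u n) @[n --> \oo] --> mean p f.
Proof.
move=> uf; apply: cvg_big => [|x _]; first exact: add_continuous.
by apply: cvgM; [exact: cvg_cst|exact: uf].
Qed.

End Mean.

(** * Discounted sums along a kernel and their one-step equation *)

Section DiscountedSum.
Context (R : realType) (X : finType) (K : X -> dist R X) (f : X -> R) (g : R).

(** The function K^t f, where [K] acts on functions by averaging. *)
Definition mean_after t : X -> R := iter t (fun h x => mean (K x) h) f.

Definition discounted_sum x : R :=
  limn (series (fun t => g ^+ t * mean_after t x)).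

Hypotheses (f01 : forall x, 0 <= f x <= 1) (g01 : 0 <= g < 1).

Lemma mean_after01 t x : 0 <= mean_after t x <= 1.
Proof.
elim: t x => [//|t IH] x /=; apply/andP; split.
  by rewrite -[leLHS](mean_cst (K x)) mean_le// => y; have /andP[] := IH y.
by rewrite -[leRHS](mean_cst (K x)) mean_le// => y; have /andP[] := IH y.
Qed.

Lemma is_cvg_discounted (u : nat -> R) :
  (forall t, 0 <= u t <= 1) -> cvgn (series (fun t => g ^+ t * u t)).
Proof.
move=> u01; have /andP[g0 g1] := g01.
apply: (@series_le_cvg _ _ (geometric 1 g)).
- by move=> t; rewrite mulr_ge0 ?exprn_ge0//; have /andP[] := u01 t.
- by move=> t; rewrite /= mul1r exprn_ge0.
- by move=> t; rewrite /= mul1r ler_piMr ?exprn_ge0//; have /andP[] := u01 t.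
- by apply: is_cvg_geometric_series; rewrite ger0_norm.
Qed.

Lemma cvg_discounted_sum x :
  series (fun t => g ^+ t * mean_after t x) @ \oo --> discounted_sum x.
Proof. by apply: is_cvg_discounted => t; exact: mean_after01. Qed.

Lemma cvg_mean_discounted_sum (mu : dist R X) :
  series (fun t => g ^+ t * mean mu (mean_after t)) @ \oo -->
  mean mu discounted_sum.
Proof.
have := cvg_mean (p := mu) cvg_discounted_sum.
rewrite (_ : (fun n => mean mu _) =
  series (fun t => g ^+ t * mean mu (mean_after t)))//.
apply/funext => n; rewrite /mean /series/=.
under eq_bigr do rewrite mulr_sumr.
rewrite exchange_big; apply: eq_bigr => t _; rewrite mulr_sumr.
by apply: eq_bigr => x _; rewrite mulrCA.
Qed.

(** Peel off the term t = 0: since [mean_after] at t.+1 averages [mean_after] at t over [K x], the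
    rest is [g] times the previous series with initial law [K x]. *)
Lemma discounted_sumE x :
  discounted_sum x = f x + g * mean (K x) discounted_sum.
Proof.
rewrite {1}/discounted_sum; apply: cvg_lim => //; rewrite -(cvg_shiftS (series _)).
rewrite (_ : (fun n => _) = (fun n => f x + g *
    series (fun t => g ^+ t * mean (K x) (mean_after t)) n)); last first.
  apply/funext => n; rewrite /series/= big_nat_recl//= expr0 mul1r mulr_sumr.
  by congr (_ + _); apply: eq_bigr => t _; rewrite exprS mulrA.
apply: cvgD; [exact: cvg_cst|apply: cvgM; first exact: cvg_cst].
exact: cvg_mean_discounted_sum.
Qed.

End DiscountedSum.

(** * From the probability space of a chain to finite means *)

Section ChainExpectation.
Context (R : realType) (X : finType) (mu : dist R X) (K : X -> dist R X).
Context (m : markov_chain mu K).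
Implicit Types (f : X -> R).

Let P := chain_prob m.
Let Z := chain_at m.

Lemma measurable_chain_at f (t : nat) : measurable_fun setT (f \o Z t).
Proof.
move=> _ B _; rewrite setTI.
rewrite (_ : _ @^-1` _ = \bigcup_(x in [set x | B (f x)]) [set w | Z t w = x]).
  apply: fin_bigcup_measurable; first exact: finite_finset.
  by move=> x _; exact: measurable_chain.
by apply/seteqP; split => w /=; [move=> h; exists (Z t w)|case=> x /= h ->].
Qed.

Lemma measurable_chain_cylinder (x : nat -> X) n :
  measurable [set w | forall t, (t <= n)%N -> Z t w = x t].
Proof.
rewrite (_ : mkset _ = \bigcap_(t in `I_n.+1) [set w | Z t w = x t]).
  apply: bigcap_measurable => [|t _]; last exact: measurable_chain.
  by exists 0%N.
by apply/seteqP; split => w h t /=; [move=> tn; exact: h|exact: h].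
Qed.

Lemma integral_chain_split (D : set (chain_space m)) f t r :
  measurable D -> (forall x, 0 <= f x) ->
  (\int[P]_(w in D) (f (Z t w))%:E =
   \sum_x \int[P]_(w in D `&` [set w | Z r w = x]) (f (Z t w))%:E)%E.
Proof.
move=> mD f0; rewrite -[RHS]ge0_integral_bigsetU.
- congr (integral _ _ _); rewrite -bigcup_seq; apply/seteqP; split => w /=.
    by move=> Dw; exists (Z r w) => //=; rewrite mem_index_enum.
  by case=> x _ [].
- by move=> x; apply: measurableI => //; exact: measurable_chain.
- exact: index_enum_uniq.
- by move=> x y _ _ [w [[_ <-] [_ <-]]].
- apply/measurable_EFinP; apply: (@measurable_funS _ _ _ _ setT) => //.
  exact: measurable_chain_at.
- by move=> w _; rewrite lee_fin.
Qed.

(** The Markov property in integrated form. Conditioning is on the whole past because [chain_law]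
    gives the probabilities of cylinders; the induction splits on the state at time n.+1, which
    lengthens the cylinder by one. *)
Lemma integral_chain_cylinder f x n k : (forall x, 0 <= f x) ->
  (\int[P]_(w in [set w | forall t, (t <= n)%N -> Z t w = x t])
     (f (Z (n + k) w))%:E =
   P [set w | forall t, (t <= n)%N -> Z t w = x t] *
     (mean_after K f k (x n))%:E)%E.
Proof.
move=> f0; elim: k n x => [|k IH] n x.
  rewrite addn0 muleC -integral_cst; last exact: measurable_chain_cylinder.
  by apply: eq_integral => w /[!inE] /= /(_ n (leqnn n)) ->.
rewrite (integral_chain_split _ n.+1)//; last exact: measurable_chain_cylinder.
rewrite chain_law /= /mean -EFinM mulr_sumr -sumEFin.
(* The path [x] redirected to [z] at time n.+1, so that each piece of the split is again a
   cylinder. *)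
pose xz z t := if t == n.+1 then z else x t.
have xzE z t : (t <= n)%N -> xz z t = x t by rewrite /xz; case: eqP => // -> /[!ltnn].
transitivity (\sum_z \int[P]_(w in [set w | forall t, (t <= n.+1)%N ->
    Z t w = xz z t]) (f (Z (n.+1 + k) w))%:E)%E.
  apply: eq_bigr => z _; rewrite addSnnS; congr (integral _ _ _).
  apply/seteqP; split => w /=.
    move=> [h hz] t; rewrite leq_eqVlt => /predU1P[->|tn].
      by rewrite /xz eqxx.
    by rewrite xzE// h.
  move=> h; split; last by rewrite h// /xz eqxx.
  by move=> t tn; rewrite h ?xzE// leqW.
apply: eq_bigr => z _; rewrite IH chain_law -EFinM; congr EFin.
have xzS : xz z n.+1 = z by rewrite /xz eqxx.
rewrite big_ord_recr/= xzS !xzE//.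
under eq_bigr => t _ do rewrite !xzE// ?(ltnW (ltn_ord t))//.
by rewrite !mulrA.
Qed.

Lemma integral_chain_at f t : (forall x, 0 <= f x) ->
  (\int[P]_w (f (Z t w))%:E = (mean mu (mean_after K f t))%:E)%E.
Proof.
move=> f0; rewrite (integral_chain_split _ 0)// /mean -sumEFin.
apply: eq_bigr => z _; rewrite setTI.
rewrite (_ : mkset _ = [set w | forall i, (i <= 0)%N -> Z i w = z]).
  by rewrite (integral_chain_cylinder (fun=> z))// chain_law big_ord0 mulr1.
apply/seteqP; split=> w /=; first by move=> h i; rewrite leqn0 => /eqP ->.
exact.
Qed.

(** Nonnegative terms allow integral and series to be exchanged, and the resulting series converges
    in the reals, so [fine] truncates nothing. All later arguments use finite means only. *)
Lemma expected_discounted_sum f (g : R) :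
  (forall x, 0 <= f x <= 1) -> 0 <= g < 1 ->
  fine (expectation P (fun w => limn (series (fun t => g ^+ t * f (Z t w))))) =
  mean mu (discounted_sum K f g).
Proof.
move=> f01 g01; have /andP[g0 _] := g01.
have f0 x : 0 <= f x by have /andP[] := f01 x.
have EFin_series (u : nat -> R) : cvgn (series u) ->
    ((limn (series u))%:E = \sum_(0 <= t <oo) (u t)%:E)%E.
  move=> cu; rewrite -EFin_lim//; congr (limn _).
  by apply/funext => n; rewrite /= /series/= sumEFin.
rewrite unlock; under eq_integral do
  (rewrite EFin_series; last exact: is_cvg_discounted).
rewrite integral_nneseries//; last 2 first.
- move=> t; apply/measurable_EFinP.
  exact: (measurable_chain_at (fun x => g ^+ t * f x)).
- by move=> t w _; rewrite lee_fin mulr_ge0 ?exprn_ge0.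
under eq_eseriesr => t _.
  rewrite (eq_integral (fun w => (g ^+ t)%:E * (f (Z t w))%:E)%E); last first.
    by move=> w _; rewrite EFinM.
  rewrite ge0_integralZl_EFin ?exprn_ge0//; last 2 first.
  - by move=> w _; rewrite lee_fin.
  - by apply/measurable_EFinP; exact: measurable_chain_at.
  rewrite integral_chain_at// -EFinM.
  over.
have c := @cvg_mean_discounted_sum _ _ K _ _ f01 g01 mu.
rewrite -EFin_series/=; first exact: (cvg_lim _ c).
by apply/cvg_ex; eexists; exact: c.
Qed.

End ChainExpectation.

(** * Exponential reweighting of a distribution and its normalizer *)

Section ExponentialTilt.
Context (R : realType) (A : finType) (p p' : dist R A) (y : A -> R).
Let Z := \sum_b p b * expR (y b).
Hypothesis p'E : forall a, p' a = p a * expR (y a) / Z.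

Lemma tilt_normalizer_gt0 : 0 < Z.
Proof.
have Z0 : 0 <= Z.
  by apply: sumr_ge0 => b _; rewrite mulr_ge0 ?dist_ge0 ?expR_ge0.
(* Division by zero yields 0, so a zero normalizer would give [p'] total mass 0. *)
rewrite lt_neqAle Z0 andbT; apply/eqP => Z00; have /eqP := dist_sum1 p'.
rewrite big1 ?(eq_sym 0) ?oner_eq0// => a _.
by rewrite p'E -Z00 invr0 mulr0.
Qed.

Lemma tiltE a : p' a = p a * expR (y a - ln Z).
Proof. by rewrite p'E expRB lnK ?mulrA// posrE tilt_normalizer_gt0. Qed.

(* The difference of the two sides is the relative entropy of p' from p. *)
Lemma ln_tilt_normalizer_le : ln Z <= mean p' y.
Proof.
rewrite -subr_ge0 -[X in _ - X](mean_cst p') -meanN -meanD.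
(* With 0 written as the difference of the masses of [p'] and [p], each term reduces to 1 + x <= exp
   x at x = ln Z - y a. *)
rewrite -(subrr 1) -{1}(dist_sum1 p') -(dist_sum1 p) -sumrB.
apply: ler_sum => a _.
have -> : p a = p' a * expR (ln Z - y a).
  by rewrite tiltE -mulrA -expRD (_ : _ + _ = 0) ?expR0 ?mulr1//; ring.
have := ler_wpM2l (dist_ge0 p' a) (expR_ge1Dx (ln Z - y a)); lra.
Qed.

(** Averaging 1 + y <= exp y under [p] gives Z >= 1. *)
Lemma ln_tilt_normalizer_ge0 : mean p y = 0 -> 0 <= ln Z.
Proof.
move=> y0; rewrite ln_ge0// -[1]addr0 -y0 -(mean_cst p 1) -meanD.
by apply: mean_le => a; exact: expR_ge1Dx.
Qed.

End ExponentialTilt.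

(** * Bellman equations, comparison principles and policy improvement *)

Section Bellman.
Context (R : realType) (S A : finType) (M : MDP R S A).
Implicit Types (pi : policy R S A) (s : S) (a : A) (U : S -> R).

Let g01 := discount_itv M.
Let g0 : 0 <= discount M. Proof. by case/andP: g01. Qed.
Let g1 : discount M < 1. Proof. by case/andP: g01. Qed.

Lemma expected_returnE pi init :
  expected_return M pi init = mean init (discounted_sum
    (fun sa => dist_pair (trans M sa.1 sa.2) pi)
    (fun sa => reward M sa.1 sa.2) (discount M)).
Proof.
apply: (expected_discounted_sum (trajectory M pi init) _ g01) => -[s a].
exact: reward_itv.
Qed.

Lemma valueE pi s : value M pi s = mean (pi s) (qvalue M pi s).
Proof.
rewrite /value expected_returnE mean_pair mean_dirac.
by apply: eq_bigr => a _; rewrite /qvalue expected_returnE mean_dirac.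
Qed.

Definition backup U s a : R := reward M s a + discount M * mean (trans M s a) U.

Lemma qvalueE pi s a : qvalue M pi s a = backup (value M pi) s a.
Proof.
rewrite /qvalue expected_returnE mean_dirac discounted_sumE//; last first.
  by case=> s' a'; exact: reward_itv.
rewrite mean_pair /backup/=; congr (_ + _ * _); apply: eq_bigr => s' _.
congr (_ * _); rewrite valueE; apply: eq_bigr => a' _.
by rewrite /qvalue expected_returnE mean_dirac.
Qed.

Lemma mean_advantage pi s : mean (pi s) (advantage M pi s) = 0.
Proof. by rewrite meanD meanN mean_cst -valueE subrr. Qed.

(** A maximum principle: at a maximizer m of [U] the hypothesis gives U m <= gamma * U m, and gamma
    < 1 forces U m <= 0. *)
Lemma discounted_subinvariant_le0 pi U :
  (forall s, U s <= discount M * mean (pi s) (fun a => mean (trans M s a) U)) ->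
  forall s, U s <= 0.
Proof.
move=> hU s; case: (@arg_maxP _ _ _ s xpredT U isT) => m _ mU.
apply: (le_trans (mU s isT)).
have : mean (pi m) (fun a => mean (trans M m a) U) <= U m.
  rewrite -[leRHS](mean_cst (pi m)); apply: mean_le => a.
  by rewrite -[leRHS](mean_cst (trans M m a)); apply: mean_le => s'; exact: mU.
move=> /(ler_wpM2l g0)/(le_trans (hU m)) h.
by rewrite leNgt; apply/negP => Um0; have := g1; nra.
Qed.

(** The maximum principle applies to V^pi - U. This lemma both bounds all values uniformly and
    proves the limit of the iterates optimal. *)
Lemma value_le_supersolution U pi s :
  (forall s a, backup U s a <= U s) -> value M pi s <= U s.
Proof.
move=> hU; rewrite -subr_le0; move: s.
apply: (@discounted_subinvariant_le0 pi) => s.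
rewrite valueE -meanZ -[X in _ - X](mean_cst (pi s)) -meanN -meanD.
apply: mean_le => a; rewrite qvalueE meanD meanN mulrBr.
have := hU s a; rewrite /backup; lra.
Qed.

Lemma backup_le U U' s a : (forall s, U s <= U' s) -> backup U s a <= backup U' s a.
Proof. by move=> UU'; rewrite lerD2l ler_wpM2l ?mean_le. Qed.

Lemma value_le_horizon pi s : value M pi s <= (1 - discount M)^-1.
Proof.
apply: (@value_le_supersolution (fun=> (1 - discount M)^-1)) => s' a.
rewrite /backup mean_cst; have /andP[_ r1] := reward_itv M s' a.
have := mulVf (lt0r_neq0 (_ : 0 < 1 - discount M)); rewrite subr_gt0 => /(_ g1).
lra.
Qed.

Lemma value_le_opt pi s : value M pi s <= opt_value M s.
Proof.
apply: ub_le_sup; last by exists pi.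
by exists (1 - discount M)^-1 => _ [pi' _ <-]; exact: value_le_horizon.
Qed.

Lemma qvalue_le_opt pi s a : qvalue M pi s a <= opt_qvalue M s a.
Proof.
apply: ub_le_sup; last by exists pi.
exists (backup (fun=> (1 - discount M)^-1) s a) => _ [pi' _ <-].
by rewrite qvalueE; apply: backup_le => s'; exact: value_le_horizon.
Qed.

(** The recursive form of the performance difference identity; unrolling it would produce the
    discounted visitation distribution. *)
Lemma performance_difference pi pi' s :
  value M pi' s - value M pi s = mean (pi' s) (advantage M pi s) +
    discount M * mean (pi' s) (fun a =>
      mean (trans M s a) (fun x => value M pi' x - value M pi x)).
Proof.
rewrite -meanZ -meanD valueE -[X in _ - X](mean_cst (pi' s)) -meanN -meanD.
apply: eq_bigr => a _; congr (_ * _).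
rewrite /advantage !qvalueE /backup meanD meanN; ring.
Qed.

Lemma value_improvement pi pi' :
  (forall s, 0 <= mean (pi' s) (advantage M pi s)) ->
  forall s, mean (pi' s) (advantage M pi s) <= value M pi' s - value M pi s.
Proof.
move=> h.
have V0 s : value M pi s - value M pi' s <= 0.
  move: s; apply: (@discounted_subinvariant_le0 pi') => s.
  have <- : - mean (pi' s) (fun a => mean (trans M s a)
        (fun x => value M pi' x - value M pi x)) =
      mean (pi' s) (fun a => mean (trans M s a)
        (fun x => value M pi x - value M pi' x)).
    rewrite -meanN; apply: eq_bigr => a _; rewrite -meanN; congr (_ * _).
    by apply: eq_bigr => x _; rewrite opprB.
  have := h s; have := performance_difference pi pi' s; lra.
move=> s; rewrite performance_difference lerDl mulr_ge0// -(mean_cst (pi' s) 0).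
apply: mean_le => a; rewrite -(mean_cst (trans M s a) 0); apply: mean_le => s'.
by rewrite -subr_le0 sub0r opprB.
Qed.

End Bellman.

(** * Growth of the NPG probabilities and optimality of the limit *)

Section SoftmaxNPG.
Context (R : realType) (S A : finType) (M : MDP R S A) (eta : R).
Context (pi : nat -> policy R S A).
Hypotheses (eta0 : 0 < eta) (hpi : softmax_npg M eta pi).

Let V k := value M (pi k).
Let adv k := advantage M (pi k).

Let stepE k s a : pi k.+1 s a = pi k s a * expR (eta * adv k s a) /
  \sum_b pi k s b * expR (eta * adv k s b).
Proof. exact: hpi.2. Qed.

Lemma npg_gt0 k s a : 0 < pi k s a.
Proof.
elim: k s a => [|k IH] s a; first exact: hpi.1.
by rewrite (tiltE (stepE k s)) mulr_gt0 ?expR_gt0.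
Qed.

Let ln_normalizer_ge0 k s : 0 <= ln (\sum_b pi k s b * expR (eta * adv k s b)).
Proof.
apply: (ln_tilt_normalizer_ge0 (y := fun b => eta * adv k s b)).
by rewrite meanZ mean_advantage mulr0.
Qed.

Let ln_normalizer_le k s : ln (\sum_b pi k s b * expR (eta * adv k s b)) <=
  eta * mean (pi k.+1 s) (adv k s).
Proof.
rewrite -meanZ.
exact: (ln_tilt_normalizer_le (y := fun b => eta * adv k s b) (stepE k s)).
Qed.

Let mean_adv_ge0 k s : 0 <= mean (pi k.+1 s) (adv k s).
Proof.
by rewrite -(pmulr_rge0 _ eta0) (le_trans (ln_normalizer_ge0 _ _) (ln_normalizer_le _ _)).
Qed.

Lemma npg_valueS k s : V k s <= V k.+1 s.
Proof.
rewrite -subr_ge0; apply: (le_trans (mean_adv_ge0 k s)).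
exact: value_improvement.
Qed.

Lemma npg_growth k s a :
  pi k s a * expR (eta * (adv k s a - (V k.+1 s - V k s))) <= pi k.+1 s a.
Proof.
rewrite (tiltE (stepE k s)) ler_wpM2l ?dist_ge0// ler_expR mulrBr lerD2l lerN2.
apply: (le_trans (ln_normalizer_le k s)); rewrite ler_pM2l//.
exact: value_improvement.
Qed.

Lemma npg_growth_iter (c : R) T s a :
  (forall k, (T <= k)%N -> c <= adv k s a - (V k.+1 s - V k s)) ->
  forall k, (T <= k)%N -> pi T s a * expR (eta * c * (k - T)%:R) <= pi k s a.
Proof.
move=> hc k /subnKC <-; rewrite addKn; elim: (k - T)%N => [|n IH].
  by rewrite mulr0 expR0 mulr1 addn0.
rewrite addnS; apply: le_trans (npg_growth _ _ _).
rewrite -natr1 mulrDr mulr1 expRD mulrA ler_pM ?expR_ge0//.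
  by rewrite mulr_ge0 ?dist_ge0 ?expR_ge0.
by rewrite ler_expR ler_pM2l// hc// leq_addr.
Qed.

Definition limit_value s : R := limn (V^~ s).

Lemma cvg_npg_value s : V^~ s @ \oo --> limit_value s.
Proof.
apply: nondecreasing_is_cvgn.
  by apply/nondecreasing_seqP => k; exact: npg_valueS.
by exists (1 - discount M)^-1 => _ [k _ <-]; exact: value_le_horizon.
Qed.

(** A^k is the backup of V^k minus V^k, hence continuous in V^k, and the increments of a convergent
    sequence vanish. *)
Lemma cvg_npg_growth_rate s a :
  adv k s a - (V k.+1 s - V k s) @[k --> \oo] -->
  backup M limit_value s a - limit_value s.
Proof.
rewrite -[X in _ --> X]subr0 -[X in _ - X](subrr (limit_value s)).
apply: cvgB; last first.
  by apply: cvgB; [rewrite (cvg_shiftS (V^~ s))|]; exact: cvg_npg_value.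
apply: cvgB; last exact: cvg_npg_value.
under eq_cvg do rewrite qvalueE.
apply: cvgD; first exact: cvg_cst.
apply: cvgM; first exact: cvg_cst.
by apply: cvg_mean => s'; exact: cvg_npg_value.
Qed.

(** Used twice: with c > 0 to exclude a positive limiting advantage, and with c = -(gap + sigma) for
    the final bound. *)
Lemma npg_eventual_growth (c : R) s a :
  c < backup M limit_value s a - limit_value s ->
  exists T, forall k, (T <= k)%N ->
    pi T s a * expR (eta * c * (k - T)%:R) <= pi k s a.
Proof.
move=> hc; have [T _ hT] := cvgr_ge _ (@cvg_npg_growth_rate s a) _ hc.
by exists T; apply: npg_growth_iter => k; exact: hT.
Qed.

(* Otherwise the probability of a in state s would grow geometrically. *)
Lemma backup_limit_value_le s a : backup M limit_value s a <= limit_value s.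
Proof.
rewrite -subr_le0 leNgt; apply/negP => h.
set c := (backup M limit_value s a - limit_value s) / 2.
have c0 : 0 < c by rewrite divr_gt0.
have [|T hT] := @npg_eventual_growth c s a; first by rewrite /c; lra.
have p0 := npg_gt0 T s a.
have ec0 : 0 < pi T s a * (eta * c) by rewrite mulr_gt0// mulr_gt0.
(* Chosen so that n * pi^T(a|s) * eta * c > 1; by 1 + x <= exp x this linear growth already pushes
   the probability above 1. *)
set n := Num.bound (pi T s a * (eta * c))^-1.
have := hT (T + n)%N (leq_addr _ _); apply/negP; rewrite -ltNge addKn.
apply: (@le_lt_trans _ _ 1).
  rewrite -(dist_sum1 (pi (T + n) s)) (bigD1 a)//= lerDl.
  by apply: sumr_ge0 => b _; exact: dist_ge0.
have h1 : 1 < pi T s a * (eta * c) * n%:R.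
  rewrite mulrC -ltr_pdivrMr// div1r.
  by apply: archi_boundP; rewrite invr_ge0 ltW.
apply: (lt_le_trans h1); rewrite -mulrA ler_wpM2l ?(ltW p0)//.
have := expR_ge1Dx (eta * c * n%:R); lra.
Qed.

(** Each V^k is at most V^*; conversely [limit_value] is a supersolution, so it dominates the value
    of every policy. *)
Lemma limit_valueE s : limit_value s = opt_value M s.
Proof.
apply/eqP; rewrite eq_le; apply/andP; split.
  apply: limr_le; first by apply/cvg_ex; eexists; exact: cvg_npg_value.
  by apply: nearW => k; exact: value_le_opt.
apply: ge_sup; first by exists (V 0%N s); exists (pi 0%N).
move=> _ [pi' _ <-]; apply: value_le_supersolution => s' a.
exact: backup_limit_value_le.
Qed.

(** Since Q^* is defined as a supremum of its own, its Bellman equation has to be proved: Q^k <= Q^*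
    passes to the limit, and Q^pi is at most the backup of V^*. *)
Lemma backup_limit_valueE s a : backup M limit_value s a = opt_qvalue M s a.
Proof.
apply/eqP; rewrite eq_le; apply/andP; split.
  have c : backup M (V k) s a @[k --> \oo] --> backup M limit_value s a.
    apply: cvgD; first exact: cvg_cst.
    apply: cvgM; first exact: cvg_cst.
    by apply: cvg_mean => s'; exact: cvg_npg_value.
  rewrite -(cvg_lim _ c)//; apply: limr_le; first by apply/cvg_ex; eexists; exact: c.
  by apply: nearW => k; rewrite -qvalueE; exact: qvalue_le_opt.
apply: ge_sup; first by exists (qvalue M (pi 0%N) s a); exists (pi 0%N).
move=> _ [pi' _ <-]; rewrite qvalueE; apply: backup_le => s'.
by rewrite limit_valueE; exact: value_le_opt.
Qed.

Lemma opt_advantageE s a :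
  opt_advantage M s a = backup M limit_value s a - limit_value s.
Proof. by rewrite /opt_advantage limit_valueE backup_limit_valueE. Qed.

(** A property of [M] alone, read off from the limit of the iterates. *)
Lemma opt_advantage_le0 s a : opt_advantage M s a <= 0.
Proof. by rewrite opt_advantageE subr_le0; exact: backup_limit_value_le. Qed.

End SoftmaxNPG.

(** * The lower bound on the suboptimality *)

Lemma opt_value_sub_ge (R : realType) (S A : finType) (M : MDP R S A)
    (pi : policy R S A) s a :
  (forall b, opt_advantage M s b <= 0) ->
  - opt_advantage M s a * pi s a <= opt_value M s - value M pi s.
Proof.
(* As Q^pi <= Q^*, the difference of values is at least the mean of -A^*, whose terms are all
   nonnegative; only that of [a] is kept. *)
move=> A0; apply: (@le_trans _ _ (- mean (pi s) (opt_advantage M s))).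
  rewrite mulrC -meanN /mean (bigD1 a)//= lerDl.
  by apply: sumr_ge0 => b _; rewrite mulr_ge0 ?dist_ge0 ?oppr_ge0.
rewrite meanD meanN mean_cst opprB lerD2l lerN2 valueE.
by apply: mean_le => b; exact: qvalue_le_opt.
Qed.

Theorem theorem5p6 (R : realType) (S A : finType) (M : MDP R S A)
    (rho : dist R S) (eta sigma : R) (pi : nat -> policy R S A)
    (hS : nontrivial_states M !=set0) (hrho : 0 < min_dist rho)
    (heta : 0 < eta) (hsigma : 0 < sigma) (hpi : softmax_npg M eta pi) :
  exists T : nat, forall k : nat, (T <= k)%N ->
    mean rho (opt_value M) - mean rho (value M (pi k)) >=
    min_dist rho * gap M * min_policy (pi T) *
      expR (- eta * (gap M + sigma) * (k - T)%:R).
Proof.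
pose G := [set `|opt_advantage M sa.1 sa.2| | sa in
  [set sa : S * A | nontrivial_states M sa.1 /\ ~ opt_actions M sa.1 sa.2]].
have G_lb : has_lbound G by exists 0 => _ [sa _ <-].
have G0 : G !=set0.
  case: hS => s hs; suff [a ha] : exists a, ~ opt_actions M s a.
    by exists `|opt_advantage M s a|; exists (s, a).
  have /eqP hs' : opt_actions M s != setT := hs.
  by apply/existsNP => h; apply: hs'; apply/seteqP; split=> // a _; exact: h.
(* A pair within sigma of the infimum is enough: its strict bound |A^*(s,a)| < gap + sigma puts the
   rate -(gap + sigma) below the limiting growth rate A^*(s,a). *)
have [_ [[s a] /= hsa <-] Ahi] := inf_adherent hsigma (conj G0 G_lb).
have Alo : gap M <= `|opt_advantage M s a| by apply: ge_inf => //; exists (s, a).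
rewrite -/(gap M) in Ahi.
have gap0 : 0 <= gap M by apply: lb_le_inf => // _ [sa _ <-].
have A0 := opt_advantage_le0 heta hpi.
rewrite ler0_norm// in Alo Ahi.
have [|T hT] := @npg_eventual_growth _ _ _ M _ _ heta hpi (- (gap M + sigma)) s a.
  by rewrite -(opt_advantageE heta hpi); lra.
exists T => k Tk; rewrite -meanN -meanD.
have rho_s : min_dist rho <= rho s.
  by apply: ge_inf; [exists 0 => _ [x _ <-]; exact: dist_ge0|exists s].
have pi_sa : min_policy (pi T) <= pi T s a.
  by apply: ge_inf; [exists 0 => _ [x _ <-]; exact: dist_ge0|exists (s, a)].
have pi_ge0 : 0 <= min_policy (pi T).
  by apply: lb_le_inf; [exists (pi T s a); exists (s, a)|
    move=> _ [x _ <-]; exact: dist_ge0].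
(* All states other than [s] contribute nonnegatively to the mean and are discarded. *)
apply: (@le_trans _ _ (rho s * (opt_value M s - value M (pi k) s))); last first.
  rewrite /mean (bigD1 s)//= lerDl; apply: sumr_ge0 => x _.
  by rewrite mulr_ge0 ?dist_ge0// subr_ge0 value_le_opt.
rewrite -!mulrA; apply: ler_pM => //; first exact: ltW.
  by rewrite mulr_ge0// mulr_ge0 ?expR_ge0.
apply: le_trans (opt_value_sub_ge (pi k) a (A0 s)).
apply: ler_pM => //; first by rewrite mulr_ge0 ?expR_ge0.
apply: le_trans (hT k Tk); rewrite mulrA (mulrN eta) -(mulNr eta).
by rewrite ler_wpM2r ?expR_ge0.
Qed.
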